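(* Let $\lambda$ be a nonzero real number. For any nonnegative integers $n,l$ with $n\ge l$, $$\sum_{k=l}^{n}S_{2,\lambda}(n,k)\,S_{1,\lambda}(k,l)=\begin{cases}1,&\text{if } l=n,\\0,&\text{otherwise,}\end{cases}$$ and $$\sum_{k=l}^{n}S_{1,\lambda}(n,k)\,S_{2,\lambda}(k,l)=\begin{cases}1,&\text{if } l=n,\\0,&\text{otherwise.}\end{cases}$$
   Context: For $x\in\mathbb{R}$: $(x)_0=1$, $(x)_n=x(x-1)\cdots(x-n+1)$ for $n\ge1$; $(x)_{0,\lambda}=1$, $(x)_{n,\lambda}=x(x-\lambda)\cdots(x-(n-1)\lambda)$ for $n\ge 1$. The degenerate Stirling numbers of the first kind $S_{1,\lambda}(n,l)$ and of the second kind $S_{2,\lambda}(n,l)$ are defined by the polynomial identities in $x$, for $n\ge0$: $(x)_n=\sum_{l=0}^n S_{1,\lambda}(n,l)(x)_{l,\lambda}$ and $(x)_{n,\lambda}=\sum_{l=0}^n S_{2,\lambda}(n,l)(x)_{l}$. *)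

(* Defs.v *)
From mathcomp Require Import all_boot all_order all_algebra.
From mathcomp Require Import reals.

Set Implicit Arguments.
Unset Strict Implicit.
Unset Printing Implicit Defensive.

Import Order.TTheory GRing.Theory Num.Theory.
Local Open Scope ring_scope.

Definition falling (R : realType) (x : R) (n : nat) : R :=
  \prod_(i < n) (x - i%:R).

Definition dfalling (R : realType) (lam x : R) (n : nat) : R :=
  \prod_(i < n) (x - i%:R * lam).

(* The polynomial identities in x are stated as identities for all real x.
   They determine S n l uniquely for l <= n; for l > n, where they say nothing,
   the value is fixed to 0 by convention. *)
Definition dstirling1_spec (R : realType) (lam : R) (S : nat -> nat -> R) :=
  (forall n x, falling x n = \sum_(l < n.+1) S n l * dfalling lam x l) /\
  (forall n l, (n < l)%N -> S n l = 0).

Definition dstirling2_spec (R : realType) (lam : R) (S : nat -> nat -> R) :=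
  (forall n x, dfalling lam x n = \sum_(l < n.+1) S n l * falling x l) /\
  (forall n l, (n < l)%N -> S n l = 0).

Lemma dfalling_connection (R : realType) (mu nu : R) :
  {S : nat -> nat -> R |
    (forall n x, dfalling mu x n = \sum_(l < n.+1) S n l * dfalling nu x l) /\
    (forall n l, (n < l)%N -> S n l = 0)}.
Proof.
pose fix S (n l : nat) {struct n} : R := if n is m.+1 then
  (if l is k.+1 then S m k else 0) + (l%:R * nu - m%:R * mu) * S m l
  else (l == 0%N)%:R.
have S0 n l : (n < l)%N -> S n l = 0.
  elim: n l => [|n IH] [|l] //= ltnl.
  by rewrite IH // IH ?mulr0 ?addr0 // ltnW.
exists S; split=> // n x.
elim: n => [|n IH].
  by rewrite /dfalling big_ord_recr !big_ord0 /= mulr1 add0r.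
rewrite [LHS]/dfalling big_ord_recr /= -/(dfalling mu x n) IH.
under [RHS]eq_bigr do rewrite mulrDl.
rewrite big_split /= [X in _ = X + _]big_ord_recl mul0r add0r.
rewrite [X in _ = _ + X]big_ord_recr /= S0 // mulr0 mul0r addr0.
rewrite mulr_suml -big_split /=; apply: eq_bigr => l _.
rewrite /bump /= add1n [dfalling nu x l.+1]/dfalling big_ord_recr /=.
rewrite -/(dfalling nu x l) -[S n l * _ * _]mulrA -[_ * S n l * _]mulrA.
rewrite [_ * (S n l * _)]mulrCA -mulrDr [_ * (x - l%:R * nu)]mulrC.
by rewrite -mulrDl addrA subrK add0n [(x - _) * _]mulrC.
Qed.

Lemma falling_dfalling (R : realType) (x : R) (n : nat) :
  falling x n = dfalling 1 x n.
Proof. by apply: eq_bigr => i _; rewrite mulr1. Qed.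

Lemma dstirling1_ex (R : realType) (lam : R) :
  {S : nat -> nat -> R | dstirling1_spec lam S}.
Proof.
have [S [SE S0]] := dfalling_connection 1 lam.
by exists S; split=> // n x; rewrite falling_dfalling SE.
Qed.

Lemma dstirling2_ex (R : realType) (lam : R) :
  {S : nat -> nat -> R | dstirling2_spec lam S}.
Proof.
have [S [SE S0]] := dfalling_connection lam 1.
exists S; split=> // n x; rewrite SE.
by apply: eq_bigr => l _; rewrite falling_dfalling.
Qed.

Definition dstirling1 (R : realType) (lam : R) : nat -> nat -> R :=
  sval (dstirling1_ex lam).

Definition dstirling2 (R : realType) (lam : R) : nat -> nat -> R :=
  sval (dstirling2_ex lam).

Lemma dstirling1P (R : realType) (lam : R) :
  dstirling1_spec lam (dstirling1 lam).
Proof. exact: svalP. Qed.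

Lemma dstirling2P (R : realType) (lam : R) :
  dstirling2_spec lam (dstirling2 lam).
Proof. exact: svalP. Qed.

(* Main.v *)
Require Import Defs.
From mathcomp Require Import all_boot all_order all_algebra.
From mathcomp Require Import reals.

Import Order.TTheory GRing.Theory Num.Theory.
Local Open Scope ring_scope.

(** Expanding the degenerate falling factorials of step [mu] in those of step
    [nu] and back expresses them in terms of themselves, so the product of the
    two connection matrices is the identity by linear independence. The
    independence follows from evaluation at [x = l * mu], where the factorial of
    order [k] vanishes exactly when [l < k]: the system for the coefficients is
    triangular. Both identities are instances, as [(x)_n] has step 1. *)

Lemma dfalling_natmul_eq0 (R : realType) (mu : R) (l k : nat) :
  mu != 0 -> (dfalling mu (l%:R * mu) k == 0) = (l < k)%N.
Proof.
move=> mu0; apply/prodf_eq0/idP => [[i _]|ltlk].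
  rewrite -mulrBl mulf_eq0 (negPf mu0) orbF subr_eq0 eqr_nat => /eqP ->.
  exact: ltn_ord.
by exists (Ordinal ltlk); rewrite //= subrr.
Qed.

Lemma dfalling_free (R : realType) (mu : R) (n : nat) (c : nat -> R) :
  mu != 0 -> (forall x, \sum_(k < n) c k * dfalling mu x k = 0) ->
  forall l, (l < n)%N -> c l = 0.
Proof.
move=> mu0 sum0; elim/ltn_ind => l IH ltln.
(* At [x = l * mu] the terms with [k > l] vanish, those with [k < l] vanish by induction, and the
   factor of [c l] is nonzero. *)
have := sum0 (l%:R * mu); rewrite (bigD1 (Ordinal ltln)) //= big1 ?addr0.
  move/eqP; rewrite mulf_eq0 dfalling_natmul_eq0 // ltnn orbF.
  by move/eqP.
move=> k; rewrite -val_eqE /= neq_ltn => /orP[ltkl|ltlk].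
  by rewrite IH ?mul0r.
by apply/eqP; rewrite mulf_eq0 dfalling_natmul_eq0 // ltlk orbT.
Qed.

Lemma dfalling_connection_inv (R : realType) (mu nu : R) (S T : nat -> nat -> R)
    (n l : nat) :
  mu != 0 ->
  (forall m x, dfalling mu x m = \sum_(k < m.+1) S m k * dfalling nu x k) ->
  (forall m x, dfalling nu x m = \sum_(k < m.+1) T m k * dfalling mu x k) ->
  (forall m k, (m < k)%N -> T m k = 0) ->
  (l <= n)%N ->
  \sum_(l <= k < n.+1) S n k * T k l = if l == n then 1 else 0.
Proof.
move=> mu0 SE TE T0 le_ln.
(* The added terms have [k < l], where [T k l = 0]; the range of [k] becomes independent of [l]. *)
have -> : \sum_(l <= k < n.+1) S n k * T k l = \sum_(k < n.+1) S n k * T k l.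
  rewrite -(big_mkord predT (fun k => S n k * T k l)).
  rewrite [RHS](big_cat_nat (n := l)) ?leqW //= [X in _ = X + _]big_nat.
  by rewrite [X in _ = X + _]big1 ?add0r // => k /andP[_ ltkl]; rewrite T0 ?mulr0.
(* Coefficient of [dfalling mu x j] in the double expansion of [dfalling mu x n], minus its
   coefficient in the trivial expansion. *)
pose c j := \sum_(k < n.+1) S n k * T k j - (if j == n then 1 else 0).
apply/eqP; rewrite -subr_eq0; apply/eqP.
apply: (@dfalling_free R mu n.+1 c mu0) => // x.
under eq_bigr do rewrite mulrBl.
rewrite sumrB [X in _ - X]big_ord_recr /= eqxx mul1r [X in _ - (X + _)]big1.
  rewrite add0r SE; apply/eqP; rewrite subr_eq0; apply/eqP.
  under eq_bigr do rewrite mulr_suml.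
  rewrite exchange_big /=; apply: eq_bigr => k _.
  under eq_bigr do rewrite -mulrA.
  rewrite -mulr_sumr TE; congr (_ * _).
  (* The expansion given by [TE] stops at [j = k]; the terms with [k < j <= n] are zero by [T0]. *)
  rewrite [RHS](big_ord_widen n.+1 (fun j => T k j * dfalling mu x j)) //.
  rewrite [RHS]big_mkcond /=; apply: eq_bigr => j _.
  by case: ltnP => // ltkj; rewrite T0 ?mul0r.
by move=> j _; rewrite ltn_eqF ?mul0r.
Qed.

Theorem lemma1 (R : realType) (lam : R) (lam_neq0 : lam != 0)
    (n l : nat) (le_ln : (l <= n)%N) :
  \sum_(l <= k < n.+1) dstirling2 lam n k * dstirling1 lam k l
    = (if l == n then 1 else 0) /\
  \sum_(l <= k < n.+1) dstirling1 lam n k * dstirling2 lam k l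
    = (if l == n then 1 else 0).
Proof.
have [E1 S1_0] := dstirling1P lam; have [E2 S2_0] := dstirling2P lam.
have {}E1 m x : dfalling 1 x m =
    \sum_(k < m.+1) dstirling1 lam m k * dfalling lam x k.
  by rewrite -falling_dfalling E1.
have {}E2 m x : dfalling lam x m =
    \sum_(k < m.+1) dstirling2 lam m k * dfalling 1 x k.
  by rewrite E2; apply: eq_bigr => k _; rewrite falling_dfalling.
split; first exact: dfalling_connection_inv lam_neq0 E2 E1 S1_0 le_ln.
exact: dfalling_connection_inv (oner_neq0 R) E1 E2 S2_0 le_ln.
Qed.
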